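(* Let $q$ be a prime power, let $\alpha_1,\dots,\alpha_n\in\mathbb{F}_q$ be distinct, let $\delta\in\mathbb{F}_q$, and let $k,r$ be integers with $6\le 2k\le n$ and $1\le r\le k-1$. Suppose that the code $C_2$ generated by $G_2$ is MDS. Then $C_2$ is a non-GRS MDS code.
   Context: For distinct $\alpha_1,\dots,\alpha_n\in\mathbb{F}_q$ and $1\le r\le k-1$, $G_{r,k}$ is the $k\times n$ matrix whose rows are $(\alpha_1^e,\alpha_2^e,\dots,\alpha_n^e)$ for $e=0,1,\dots,k-r-1,k-r+1,\dots,k$ in this order (all exponents from $0$ to $k$ except $k-r$; convention $0^0=1$). For $\delta\in\mathbb{F}_q$, $G_2$ is the $k\times(n+2)$ matrix obtained by appending to $G_{r,k}$ the two columns $(0,\dots,0,0,1)^T$ and $(0,\dots,0,1,\delta)^T$, in this order, and $C_2$ is the linear code over $\mathbb{F}_q$ generated by $G_2$. An $[N,k]$ linear code is MDS if its minimum distance is $N-k+1$. A generalized Reed-Solomon (GRS) code of length $N\le q+1$ and dimension $k$ is a code $\{(v_1f(\beta_1),\dots,v_Nf(\beta_N)) : f\in\mathbb{F}_q[x],\ \deg f\le k-1\}$ with distinct $\beta_1,\dots,\beta_N\in\mathbb{F}_q\cup\{\infty\}$ and nonzero $v_i\in\mathbb{F}_q$, where $f(\infty)$ denotes the coefficient of $x^{k-1}$ in $f$. A non-GRS MDS code is an MDS code that is not (monomially) equivalent to a GRS code. *)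

(* Defs.v *)
From HB Require Import structures.
From mathcomp Require Import all_boot all_order all_fingroup all_algebra.

Set Implicit Arguments.
Unset Strict Implicit.
Unset Printing Implicit Defensive.

Import GRing.Theory.
Local Open Scope ring_scope.

(* A linear code of length N over F is a subspace of 'rV[F]_N; its dimension
   is \dim C. *)

Definition code_of (F : finFieldType) (k N : nat) (G : 'M[F]_(k, N)) :
    {vspace 'rV[F]_N} :=
  <<[seq row i G | i : 'I_k]>>%VS.

Definition hamming (F : finFieldType) (N : nat) (x y : 'rV[F]_N) : nat :=
  #|[set i | x 0 i != y 0 i]|.

(* A relation rather than a function: the zero code has no minimum distance. *)
Definition has_min_distance (F : finFieldType) (N : nat)
    (C : {vspace 'rV[F]_N}) (d : nat) : Prop :=
  (exists x y, [/\ x \in C, y \in C, x != y & hamming x y = d]) /\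
  (forall x y, x \in C -> y \in C -> x != y -> (d <= hamming x y)%N).

Definition MDS (F : finFieldType) (N : nat) (C : {vspace 'rV[F]_N}) : Prop :=
  has_min_distance C (N - \dim C + 1)%N.

(* The projective line F u {oo} is option F, with None standing for oo. *)
Definition eval_proj (F : finFieldType) (k : nat) (f : {poly F})
    (b : option F) : F :=
  if b is Some x then f.[x] else f`_k.-1.

(* Injectivity of beta forces N <= #|F| + 1. *)
Definition is_GRS (F : finFieldType) (N k : nat) (C : {vspace 'rV[F]_N}) :
    Prop :=
  (0 < k <= N)%N /\
  exists (beta : 'I_N -> option F) (v : 'I_N -> F),
    [/\ injective beta,
        forall i, v i != 0
      & forall c : 'rV[F]_N,
          c \in C <-> exists2 f : {poly F}, (size f <= k)%N &
                        c = \row_i (v i * eval_proj k f (beta i))].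

(* The matrices diag_mx a *m perm_mx s with a nowhere zero are exactly the
   monomial matrices. *)
Definition monomially_equivalent (F : finFieldType) (N : nat)
    (C D : {vspace 'rV[F]_N}) : Prop :=
  exists (a : 'rV[F]_N) (s : 'S_N),
    (forall i, a 0 i != 0) /\
    D = (linfun (mulmxr (diag_mx a *m perm_mx s)) @: C)%VS.

Definition non_GRS_MDS (F : finFieldType) (N : nat) (C : {vspace 'rV[F]_N}) :
    Prop :=
  MDS C /\
  ~ exists (k : nat) (D : {vspace 'rV[F]_N}),
      is_GRS k D /\ monomially_equivalent C D.

(* bump (k - r) enumerates 0, ..., k-r-1, k-r+1, ..., k in increasing order. *)
Definition Grk (F : finFieldType) (n k r : nat) (alpha : 'I_n -> F) :
    'M[F]_(k, n) :=
  \matrix_(i < k, j < n) alpha j ^+ bump (k - r) i.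

Definition G2 (F : finFieldType) (n k r : nat) (alpha : 'I_n -> F)
    (delta : F) : 'M[F]_(k, n + 2) :=
  row_mx (Grk k r alpha)
    (row_mx (\col_(i < k) (i.+1 == k)%:R)
            (\col_(i < k) (if i.+1 == k then delta else (i.+2 == k)%:R))
     : 'M[F]_(k, 1 + 1)).

Definition C2 (F : finFieldType) (n k r : nat) (alpha : 'I_n -> F)
    (delta : F) : {vspace 'rV[F]_(n + 2)} :=
  code_of (G2 k r alpha delta).

(* Main.v *)
(** The argument compares Schur squares.  In a GRS code of dimension [k'], the
    products of two codewords are evaluations of polynomials of degree at most
    [2k' - 2], hence span a space of dimension at most [2k' - 1].  In [C2] the
    products of the generators, restricted to the [n] affine points and to the
    first appended coordinate (the point at infinity for degree [k]), are the
    evaluations of the monomials [x^(e + e')], where [e] and [e'] avoid [k - r].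
    These sums cover [0, ..., 2k] with at most one exception, and the [n + 1 > 2k]
    projective points separate polynomials of degree at most [2k]; so the square
    of [C2] has dimension at least [2k]. *)
From HB Require Import structures.
Require Import Defs.
From mathcomp Require Import all_boot all_order all_fingroup all_algebra zify.

Set Implicit Arguments.
Unset Strict Implicit.
Unset Printing Implicit Defensive.

Import GRing.Theory.
Local Open Scope ring_scope.

Lemma eval_proj_sum (F : finFieldType) (I : finType) (k : nat) (a : I -> F)
    (f : I -> {poly F}) (b : option F) :
  eval_proj k (\sum_i a i *: f i) b = \sum_i a i * eval_proj k (f i) b.
Proof.
case: b => [x|] /=.
  by rewrite horner_sum; apply: eq_bigr => i _; rewrite hornerZ.
by rewrite coef_sum; apply: eq_bigr => i _; rewrite coefZ.
Qed.

Lemma coefM_top (R : nzRingType) (p q : {poly R}) (m : nat) :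
  (size p <= m.+1)%N -> (size q <= m.+1)%N -> (p * q)`_(m + m) = p`_m * q`_m.
Proof.
move=> sp sq; rewrite coefM.
have hm : (m < (m + m).+1)%N by lia.
rewrite (bigD1 (Ordinal hm)) //= addnK big1 ?addr0 // => i ne.
have {}ne : nat_of_ord i != m by apply: contra ne => /eqP e; apply/eqP/val_inj.
case: (ltnP i m) => h.
  by rewrite (nth_default 0 (_ : size q <= m + m - i)%N) ?mulr0 //; lia.
by rewrite (nth_default 0 (_ : size p <= i)%N) ?mul0r //; lia.
Qed.

(** The value at infinity depends on the degree bound, not on the polynomial alone; it is
    multiplicative because the bounds [m] add up to [m + m]. *)
Lemma eval_projM (F : finFieldType) (m : nat) (f g : {poly F}) (b : option F) :
  (size f <= m.+1)%N -> (size g <= m.+1)%N ->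
  eval_proj (m + m).+1 (f * g) b = eval_proj m.+1 f b * eval_proj m.+1 g b.
Proof. by case: b => [x|] sf sg /=; [rewrite hornerM | exact: coefM_top]. Qed.

(** A zero at infinity lowers the degree bound by one, so it counts as a root: there are at most
    [k - 1] zeros on the projective line. *)
Lemma eval_proj_eq0 (F : finFieldType) (I : finType) (k : nat)
    (beta : I -> option F) (f : {poly F}) :
  injective beta -> (k <= #|I|)%N -> (size f <= k)%N ->
  (forall i, eval_proj k f (beta i) = 0) -> f = 0.
Proof.
move=> inj kI sf f0; apply/eqP/negPn/negP => fn0.
pose s := map beta (enum I); pose rs := pmap id s.
have us : uniq s by rewrite map_inj_uniq ?enum_uniq.
have urs : uniq rs by apply: (@pmap_uniq _ _ id Some) us; case.
have rrs : all (root f) rs.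
  apply/allP => x; rewrite mem_pmap map_id => /mapP[i _ e].
  by rewrite /root; move: (f0 i); rewrite -e /= => ->.
have := max_poly_roots fn0 rrs urs.
have := count_predC isSome s; rewrite -(size_pmap id) -/rs size_map -cardE.
have -> : count (predC isSome) s = (None \in s).
  rewrite -(count_uniq_mem None us); apply: eq_count => -[x|] //.
case: (boolP (None \in s)) => [/mapP[i _ e]|_]; last first.
  by rewrite addn0 => -> /leq_trans/(_ sf); rewrite ltnNge kI.
rewrite addn1 => cnt rsf; move: kI; rewrite -cnt => kI.
have fk : f`_k.-1 = 0 by move: (f0 i); rewrite -e.
have : (size f <= k.-1)%N.
  have [e0|ne] := eqVneq (size f) k; last by lia.
  by move: fn0; rewrite -lead_coef_eq0 /lead_coef e0 fk eqxx.
by move/(leq_trans rsf); rewrite ltnNge => /negP; apply; case: (k) kI.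
Qed.

Lemma GRS_dim_ge (F : finFieldType) (N k : nat) (D : {vspace 'rV[F]_N}) :
  is_GRS k D -> (k <= \dim D)%N.
Proof.
move=> [/andP[_ kN] [beta [v [inj vn0 memD]]]].
pose phi (u : 'rV[F]_k) : 'rV[F]_N :=
  \row_i (v i * eval_proj k (rVpoly u) (beta i)).
have phi_lin : linear phi.
  move=> c x y; apply/rowP => i; rewrite !mxE linearP /=.
  by case: (beta i) => [z|] /=; rewrite ?(hornerD, hornerZ, coefD, coefZ);
    rewrite mulrDr mulrCA.
pose Phi := GRing.isLinear.Build _ _ _ _ phi phi_lin.
pose L : {linear 'rV[F]_k -> 'rV[F]_N} := HB.pack phi Phi.
have k0 : (fullv :&: lker (linfun L))%VS = 0%VS.
  apply/eqP; rewrite -subv0; apply/subvP => u.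
  rewrite memv_cap memv_ker lfunE /= memv0 => /andP[_ /eqP/rowP u0].
  suff: rVpoly u = 0 by move/(congr1 (@poly_rV _ k)); rewrite rVpolyK linear0 => ->.
  apply: (eval_proj_eq0 inj (k := k)); rewrite ?card_ord ?size_poly //.
  by move=> i; move: (u0 i); rewrite !mxE => /eqP; rewrite mulf_eq0 (negPf (vn0 i)) => /eqP.
have := limg_dim_eq k0; rewrite dimvf /dim /= mul1n => dimL.
rewrite -[leqLHS]dimL; apply: dimvS; apply/subvP => _ /memv_imgP[u _ ->].
by rewrite [linfun _ u](lfunE L); apply/memD; exists (rVpoly u); rewrite ?size_poly.
Qed.

Lemma GRS_monomial_preimage (F : finFieldType) (N k : nat)
    (C D : {vspace 'rV[F]_N}) :
  is_GRS k D -> monomially_equivalent C D ->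
  exists (beta : 'I_N -> option F) (v : 'I_N -> F),
    injective beta /\
    forall c, c \in C -> exists2 f : {poly F}, (size f <= k)%N &
      forall i, c 0 i = v i * eval_proj k f (beta i).
Proof.
move=> [_ [beta [v [inj _ memD]]]] [a [s [an0 DE]]].
exists (beta \o s), (fun i => (a 0 i)^-1 * v (s i)); split.
  by move=> i j /= /inj /perm_inj.
move=> c cC.
have : c *m (diag_mx a *m perm_mx s) \in D.
  rewrite DE; apply/memv_imgP; exists c => //; by rewrite lfunE.
move/memD => [f sf e]; exists f => // i.
move/rowP/(_ (s i)): e; rewrite mulmxA mul_mx_diag.
(* Right multiplication by [perm_mx s] moves coordinate [i] to [s i], so entry [s i] of the image is
   [c 0 i * a 0 i]. *)
rewrite -[X in perm_mx X]invgK -col_permE !mxE permK => e.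
by rewrite -mulrA /= -e mulrC mulfK.
Qed.

(** The only sums at risk are 1 = 0 + 1, lost when [m = 1], and 2k - 1 = k + (k - 1), lost when
    [m = k - 1]. For [k >= 3] these cases exclude each other; for [k = 2] both sums would be
    lost. *)
Lemma gapped_sums (k m : nat) :
  (3 <= k)%N -> (0 < m < k)%N ->
  exists h, forall s, (s <= 2 * k)%N -> s != h ->
    exists e e', [/\ (e <= k)%N, e != m, (e' <= k)%N, e' != m & (e + e')%N = s].
Proof.
move=> k3 /andP[m0 mk].
have [mE|mN] := eqVneq m k.-1.
  exists (2 * k).-1 => s sk sh.
  have [s1|s1] := ltnP s k.-1; first by exists 0%N, s; split; lia.
  have [s2|s2] := eqVneq s k.-1; first by exists 1%N, k.-2; split; lia.
  by exists k, (s - k)%N; split; lia.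
exists 1%N => s sk s1.
have [sm|sm] := eqVneq s m; first by exists 1%N, m.-1; split; lia.
have [sk'|sk'] := leqP s k; first by exists 0%N, s; split; lia.
have [skm|skm] := eqVneq s (k + m)%N; first by exists k.-1, m.+1; split; lia.
by exists k, (s - k)%N; split; lia.
Qed.

(* [option 'I_n] indexes all columns of [G2] but the last; [None] is the column
   [(0, ..., 0, 1)^T]. *)
Definition proj_col (n : nat) (b : option 'I_n) : 'I_(n + (1 + 1)) :=
  if b is Some j then lshift 2 j else rshift n (lshift 1 ord0).

(** Since [r > 0], the last row carries the exponent [k], so the column [(0, ..., 0, 1)^T] reads off
    the coefficient of [x^k]: it is evaluation at infinity for degree bound [k]. *)
Lemma C2_monomial (F : finFieldType) (n k r : nat) (alpha : 'I_n -> F)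
    (delta : F) (e : nat) :
  (0 < r)%N -> (e <= k)%N -> e != (k - r)%N ->
  exists2 c, c \in C2 k r alpha delta &
    forall b, c 0 (proj_col b) = eval_proj k.+1 'X^e (omap alpha b).
Proof.
move=> r0 ek er.
have ik : (unbump (k - r) e < k)%N by rewrite /unbump; lia.
pose i := Ordinal ik.
have ie : bump (k - r) i = e by rewrite unbumpK.
exists (row i (G2 k r alpha delta)).
  by apply: memv_span; apply: map_f; rewrite mem_enum.
case=> [j|] /=; rewrite mxE.
  by rewrite row_mxEl mxE ie hornerXn.
rewrite row_mxEr [LHS](@row_mxEl _ _ 1 1) mxE coefXn /= eq_sym; congr (nat_of_bool _)%:R.
by move: ie; rewrite /= /bump; lia.
Qed.

(** The product of two monomial codewords is computed twice: from the generators of [C2], and from a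
    GRS description of dimension [m.+1]. *)
Lemma C2_square (F : finFieldType) (n k r : nat) (alpha : 'I_n -> F) (delta : F)
    (m : nat) (beta : 'I_(n + 2) -> option F) (v : 'I_(n + 2) -> F) (s : nat) :
  (forall c, c \in C2 k r alpha delta ->
     exists2 f : {poly F}, (size f <= m.+1)%N &
       forall i, c 0 i = v i * eval_proj m.+1 f (beta i)) ->
  (0 < r)%N ->
  (exists e e', [/\ (e <= k)%N, e != (k - r)%N, (e' <= k)%N, e' != (k - r)%N
     & (e + e')%N = s]) ->
  exists g : {poly F}, (size g <= (m + m).+1)%N /\
    forall b, eval_proj (k + k).+1 'X^s (omap alpha b) =
      v (proj_col b) ^+ 2 * eval_proj (m + m).+1 g (beta (proj_col b)).
Proof.
move=> GRS r0 [e [e' [ek er e'k e'r <-]]].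
have [c cC cE] := C2_monomial alpha delta r0 ek er.
have [c' cC' cE'] := C2_monomial alpha delta r0 e'k e'r.
have [f sf fE] := GRS _ cC; have [f' sf' fE'] := GRS _ cC'.
exists (f * f'); split; first by have := size_polyMleq f f'; lia.
move=> b; rewrite exprD !eval_projM ?size_polyXn //.
by rewrite -cE -cE' fE fE' mulrACA expr2.
Qed.

Lemma C2_not_GRS (F : finFieldType) (n k r : nat) (alpha : 'I_n -> F)
    (delta : F) (k' : nat) (D : {vspace 'rV[F]_(n + 2)}) :
  injective alpha -> (6 <= 2 * k <= n)%N -> (1 <= r <= k - 1)%N ->
  is_GRS k' D -> ~ monomially_equivalent (C2 k r alpha delta) D.
Proof.
move=> alpha_inj hk hr GRS CD.
(* The chain is [k' <= \dim D <= \dim C2 <= k]. *)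
have kk : (k' <= k)%N.
  apply: leq_trans (GRS_dim_ge GRS) _; case: CD => a [s [_ ->]].
  apply: leq_trans (leq_trans (leq_addl _ _) (eq_leq (limg_ker_dim _ _))) _.
  apply: leq_trans (dim_span _) _.
  by rewrite size_map size_enum_ord.
have [m k'E] : exists m, k' = m.+1 by case: GRS; case: k' {CD kk} => // m; exists m.
subst k'; have [beta [v [_ GRSC]]] := GRS_monomial_preimage GRS CD.
have [r0 km] : (0 < r)%N /\ (0 < k - r < k)%N by lia.
have [h hS] : exists h, _ := gapped_sums (k := k) (m := k - r) ltac:(lia) km.
have gS (i : 'I_(2 * k)) : exists g : {poly F}, (size g <= (m + m).+1)%N /\
    forall b, eval_proj (k + k).+1 'X^(bump h i) (omap alpha b) =
      v (proj_col b) ^+ 2 * eval_proj (m + m).+1 g (beta (proj_col b)).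
  apply: (C2_square GRSC r0); apply: hS; last by rewrite eq_sym neq_bump.
  by rewrite /bump; have := ltn_ord i; lia.
have [g gP] := fin_all_exists gS.
(* As [m < k], there are 2k rows but at most 2k - 1 columns, so the [g i] satisfy a nontrivial
   linear relation [a]. *)
pose A : 'M[F]_(2 * k, (m + m).+1) := \matrix_i poly_rV (g i).
have : ~~ row_free A by rewrite /row_free; have := rank_leq_col A; lia.
rewrite -kermx_eq0 => /rowV0Pn[a /sub_kermxP aA an0].
have g0 : \sum_i a 0 i *: g i = 0.
  move/(congr1 rVpoly): aA; rewrite mulmx_sum_row linear_sum linear0 => aA.
  rewrite -[RHS]aA; apply: eq_bigr => i _.
  by rewrite linearZ /= rowK poly_rV_K //; case: (gP i).
(* The relation carries over to the monomials: [P] has degree at most 2k and vanishes at n + 1 > 2k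
   projective points. *)
pose P := \sum_i a 0 i *: 'X^(bump h i) : {poly F}.
have P0 : P = 0.
  apply: (@eval_proj_eq0 F (option 'I_n) (k + k).+1 (omap alpha)).
  - by move=> [x|] [y|] //= [/alpha_inj ->].
  - by rewrite card_option card_ord; lia.
  - apply: (leq_trans (size_sum _ _ _)); apply/bigmax_leqP => i _.
    apply: leq_trans (size_scale_leq _ _) _; rewrite size_polyXn /bump.
    by have := ltn_ord i; lia.
  move=> b; rewrite eval_proj_sum.
  transitivity (v (proj_col b) ^+ 2 *
      eval_proj (m + m).+1 (\sum_i a 0 i *: g i) (beta (proj_col b))).
    rewrite eval_proj_sum mulr_sumr; apply: eq_bigr => i _.
    by have [_ ->] := gP i; rewrite mulrCA.
  by rewrite g0; case: (beta _) => [x|] /=; rewrite ?horner0 ?coef0 mulr0.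
(* The exponents [bump h i] are distinct, so each [a 0 i] is a coefficient of [P]. *)
move/eqP: an0; apply; apply/rowP => i; rewrite mxE.
move/(congr1 (fun p : {poly F} => p`_(bump h i))): P0.
rewrite coef0 coef_sum (bigD1 i) //= coefZ coefXn eqxx mulr1 big1 ?addr0 //.
move=> j ji; rewrite coefZ coefXn (inj_eq (can_inj (bumpK h))).
by rewrite (inj_eq val_inj) eq_sym (negPf ji) mulr0.
Qed.

Local Close Scope ring_scope.

Theorem theorem5p7 (F : finFieldType) (n k r : nat) (alpha : 'I_n -> F)
    (delta : F)
    (alpha_inj : injective alpha)
    (hk : 6 <= 2 * k <= n)
    (hr : 1 <= r <= k - 1)
    (hMDS : MDS (C2 k r alpha delta)) :
  non_GRS_MDS (C2 k r alpha delta).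
Proof.
by split=> // -[k' [D [GRS CD]]]; apply: (C2_not_GRS alpha_inj hk hr GRS CD).
Qed.
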